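(* Let $f:\mathbb{R}^d\to\mathbb{R}$ be differentiable with $\|\nabla f(x)-\nabla f(y)\|\le L\|x-y\|$ for all $x,y$ (where $L>0$), and with minimum value $f^{\ast}=\min_x f(x)$. Run SGD with bandwidth-based step-size (see context) on $f$, where the stochastic gradients satisfy $\mathbb{E}[g_i^t\mid\mathcal{F}_i^t]=\nabla f(x_i^t)$ and $\mathbb{E}[\|g_i^t-\nabla f(x_i^t)\|^2\mid\mathcal{F}_i^t]\le\rho\|\nabla f(x_i^t)\|^2+\sigma$ for constants $\rho\ge 0$, $\sigma\ge 0$. Assume that there is a constant $\Delta_0>0$ such that $\mathbb{E}[f(x_1^t)-f^{\ast}]\le\Delta_0$ for each $t\ge 1$. If $\eta_i^t\le\frac{1}{(\rho+1)L}$ for all $t,i$, the stage length is $S_t=S\ge 1$, and $\delta(t)=1/\sqrt{t}$ for each $1\le t\le N$, then $$\mathbb{E}[\|\nabla f(\hat{x}_T)\|^2]\le\frac{3\Delta_0}{m}\cdot\frac{1}{\sqrt{ST}}+\frac{3M^2L\sigma}{2m}\cdot\sqrt{\frac{S}{T}}.$$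
   Context: SGD with bandwidth-based step-size. Inputs: a (deterministic) initial point $x_1^1\in\mathbb{R}^d$; positive integers $T$ (total number of iterations), $N$ (number of stages) and stage lengths $S_1,\dots,S_N$ with $\sum_{t=1}^N S_t=T$ (so $NS=T$ when all $S_t=S$); constants $0<m\le M$; a positive monotonically decreasing boundary function $\delta$ with $\delta(1)=1$; and deterministic numbers $n(t,i)\in[m,M]$ for $1\le t\le N$, $1\le i\le S_t$. For $t=1,\dots,N$ and $i=1,\dots,S_t$: the algorithm queries a stochastic gradient oracle at $x_i^t$, receiving a random vector $g_i^t$ with $\mathbb{E}[g_i^t\mid\mathcal{F}_i^t]=\nabla f(x_i^t)$; sets $\eta_i^t=n(t,i)\delta(t)$; and sets $x_{i+1}^t=x_i^t-\eta_i^t g_i^t$. At the end of stage $t$, $x_1^{t+1}=x_{S_t+1}^t$. Here $\mathcal{F}_i^t$ is the $\sigma$-algebra generated by all randomness used before the query at $x_i^t$ (so $x_i^t$ is $\mathcal{F}_i^t$-measurable). The hypothesis on $\mathbb{E}[f(x_1^t)-f^\ast]$ is for all stage-initial iterates $x_1^t$ produced, $1\le t\le N+1$. Output: independently of the run, an index $t^{\ast}\in\{1,\dots,N\}$ is drawn with probability $P_t=\delta(t)^{-1}/\sum_{l=1}^N\delta(l)^{-1}$, and then $\hat{x}_T$ is chosen uniformly from $\{x_1^{t^\ast},\dots,x_{S_{t^\ast}}^{t^\ast}\}$. *)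

(* Defs.v *)
From HB Require Import structures.
From mathcomp Require Import all_boot all_order all_algebra.
From mathcomp Require Import all_classical all_reals all_analysis.
From mathcomp Require Import measurable_realfun.

Set Implicit Arguments.
Unset Strict Implicit.
Unset Printing Implicit Defensive.

Import Order.TTheory GRing.Theory Num.Theory.
Import numFieldNormedType.Exports.

Local Open Scope classical_set_scope.
Local Open Scope ring_scope.

(* The library norm `|v| on row vectors is the sup norm. *)
Definition enorm (R : realType) (d : nat) (v : 'rV[R]_d) : R :=
  Num.sqrt (\sum_(j < d) v ord0 j ^+ 2).

Definition grad (R : realType) (d : nat) (f : 'rV[R]_d -> R) (x : 'rV[R]_d)
    : 'rV[R]_d :=
  \row_(j < d) 'D_(delta_mx ord0 j) f x.

Section conditional_expectation.
Context (dO : measure_display) (Omega : measurableType dO) (R : realType).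
Variable P : probability Omega R.

Definition measurable_wrt (F : set (set Omega)) (dY : measure_display)
    (Y : measurableType dY) (h : Omega -> Y) : Prop :=
  forall B : set Y, measurable B -> F (h @^-1` B).

(* Z is a version of E[X | F], for a sub-sigma-algebra F and a random variable
   X that is integrable or nonnegative. *)
Definition is_cond_exp (F : set (set Omega)) (X Z : Omega -> \bar R) : Prop :=
  [/\ measurable_fun setT X,
      P.-integrable setT X \/ (forall w, (0 <= X w)%E),
      measurable_wrt F Z
    & forall A, F A -> (\int[P]_(w in A) X w = \int[P]_(w in A) Z w)%E].

(* E[X | F] <= Y almost surely. *)
Definition cond_exp_le (F : set (set Omega)) (X Y : Omega -> \bar R) : Prop :=
  exists2 Z, is_cond_exp F X Z & {ae P, forall w, (Z w <= Y w)%E}.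

End conditional_expectation.

(* Stages t and inner steps i are numbered from 1, and only the values of
   t- and i-indexed families at the indices singled out by [query] (for the
   iterates, also at i = S_t + 1 and t = N + 1) are meaningful. *)
Definition query (N : nat) (Sl : nat -> nat) (t i : nat) : Prop :=
  (1 <= t <= N)%N /\ (1 <= i <= Sl t)%N.

Definition before (s j t i : nat) : Prop :=
  (s < t)%N \/ (s = t /\ (j < i)%N).

(* [xi t i] is the randomness used at query (t, i); [history N Sl xi t i] is the
   sigma-algebra F_i^t generated by all randomness used before that query.  In
   particular [history N Sl xi t i.+1] also includes [xi t i], and
   [history N Sl xi N.+1 1] is the sigma-algebra of the whole run. *)
Definition history (dO : measure_display) (Omega : measurableType dO)
    (dX : measure_display) (X : measurableType dX) (N : nat) (Sl : nat -> nat)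
    (xi : nat -> nat -> Omega -> X) (t i : nat) : set (set Omega) :=
  <<s [set A | exists s j, [/\ query N Sl s j, before s j t i &
                 exists2 B, measurable B & A = xi s j @^-1` B] ]>>.

Record bandwidth_schedule (R : realType) (T N : nat) (Sl : nat -> nat)
    (m M : R) (delta : nat -> R) (n : nat -> nat -> R) : Prop := {
  sched_N_gt0 : (0 < N)%N;
  sched_Sl_gt0 : forall t, (1 <= t <= N)%N -> (0 < Sl t)%N;
  sched_T_def : T = (\sum_(1 <= t < N.+1) Sl t)%N;
  sched_m_gt0 : 0 < m;
  sched_m_le_M : m <= M;
  sched_delta_gt0 : forall t, (1 <= t <= N)%N -> 0 < delta t;
  sched_delta_decr : forall s t, (1 <= s)%N -> (s <= t <= N)%N -> delta t <= delta s;
  sched_delta1 : delta 1%N = 1;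
  sched_n_band : forall t i, query N Sl t i -> m <= n t i <= M }.

Definition step_size (R : realType) (delta : nat -> R) (n : nat -> nat -> R)
    (t i : nat) : R := n t i * delta t.

Record sgd_iterates (R : realType) (Omega : Type) (d N : nat)
    (Sl : nat -> nat) (eta : nat -> nat -> R) (x11 : 'rV[R]_d)
    (g x : nat -> nat -> Omega -> 'rV[R]_d) : Prop := {
  iter_init : forall w, x 1%N 1%N w = x11;
  iter_step : forall t i, query N Sl t i ->
    forall w, x t i.+1 w = x t i w - eta t i *: g t i w;
  iter_stage : forall t, (1 <= t <= N)%N ->
    forall w, x t.+1 1%N w = x t (Sl t).+1 w }.

(* The oracle answer g_i^t is a random vector determined by the randomness used
   up to and including query (t, i). *)
Record stochastic_oracle (dO : measure_display) (Omega : measurableType dO)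
    (R : realType) (dX : measure_display) (X : measurableType dX) (d N : nat)
    (Sl : nat -> nat) (xi : nat -> nat -> Omega -> X)
    (g : nat -> nat -> Omega -> 'rV[R]_d) : Prop := {
  oracle_random : forall t i, query N Sl t i -> measurable_fun setT (xi t i);
  oracle_adapted : forall t i, query N Sl t i -> forall j : 'I_d,
    measurable_wrt (history N Sl xi t i.+1) (fun w => g t i w ord0 j) }.

(* E[g_i^t | F_i^t] = grad f (x_i^t), coordinate by coordinate. *)
Definition unbiased_oracle (dO : measure_display) (Omega : measurableType dO)
    (R : realType) (P : probability Omega R) (dX : measure_display)
    (X : measurableType dX) (d N : nat) (Sl : nat -> nat)
    (xi : nat -> nat -> Omega -> X) (f : 'rV[R]_d -> R)
    (g x : nat -> nat -> Omega -> 'rV[R]_d) : Prop :=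
  forall t i, query N Sl t i -> forall j : 'I_d,
    is_cond_exp P (history N Sl xi t i)
      (fun w => (g t i w ord0 j)%:E)
      (fun w => (grad f (x t i w) ord0 j)%:E).

Definition bounded_variance_oracle (dO : measure_display)
    (Omega : measurableType dO) (R : realType) (P : probability Omega R)
    (dX : measure_display) (X : measurableType dX) (d N : nat)
    (Sl : nat -> nat) (xi : nat -> nat -> Omega -> X) (f : 'rV[R]_d -> R)
    (rho sigma : R) (g x : nat -> nat -> Omega -> 'rV[R]_d) : Prop :=
  forall t i, query N Sl t i ->
    cond_exp_le P (history N Sl xi t i)
      (fun w => (enorm (g t i w - grad f (x t i w)) ^+ 2)%:E)
      (fun w => (rho * enorm (grad f (x t i w)) ^+ 2 + sigma)%:E).

Record output_index (dO : measure_display) (Omega : measurableType dO)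
    (R : realType) (P : probability Omega R) (dX : measure_display)
    (X : measurableType dX) (N : nat) (Sl : nat -> nat)
    (xi : nat -> nat -> Omega -> X) (delta : nat -> R)
    (tstar istar : Omega -> nat) : Prop := {
  index_range : forall w, query N Sl (tstar w) (istar w);
  index_measurable : measurable_fun setT tstar /\ measurable_fun setT istar;
  stage_law : forall t, (1 <= t <= N)%N ->
    P [set w | tstar w = t] =
    ((delta t)^-1 / \sum_(1 <= l < N.+1) (delta l)^-1)%:E;
  inner_uniform : forall t i, query N Sl t i ->
    P [set w | tstar w = t /\ istar w = i] =
    (P [set w | tstar w = t] * ((Sl t)%:R^-1)%:E)%E;
  index_indep : forall A, history N Sl xi N.+1 1 A -> forall t i,
    P (A `&` [set w | tstar w = t /\ istar w = i]) =
    (P A * P [set w | tstar w = t /\ istar w = i])%E }.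

Definition output (Omega V : Type) (x : nat -> nat -> Omega -> V)
    (tstar istar : Omega -> nat) (w : Omega) : V :=
  x (tstar w) (istar w) w.

(* Main.v *)
(* Since grad f is L-Lipschitz, f(y - eta g) <= f(y) - eta <grad f(y), g> + L eta^2 |g|^2 / 2.
   Taking expectations, the noise g - grad f(y) is orthogonal to grad f(y), and
   eta <= 1/((rho+1)L) absorbs the multiplicative part of the variance, so one
   query satisfies
     eta E|grad f(x_i)|^2 <= 2 (E f(x_i) - E f(x_{i+1})) + L eta^2 sigma.
   Sum over stage t with m delta(t) <= eta <= M delta(t) and multiply by
   delta(t)^{-2} = t.  The gaps a_t = E f(x_1^t) - f* then enter through
   sum_t t (a_t - a_{t+1}) <= sum_t a_t <= N Delta0 (summation by parts, which
   gains a factor of order N over bounding each stage separately), while the weights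
   of the output law are normalized by sum_t sqrt t >= (2/3) N^{3/2}.

   Integrability propagates along the run because |grad f|^2 <= 2L (f - f* ). *)
Require Import Defs.
From HB Require Import structures.
From mathcomp Require Import all_boot all_order all_algebra.
From mathcomp Require Import all_classical all_reals all_analysis.
From mathcomp Require Import measurable_realfun ring lra.

Set Implicit Arguments.
Unset Strict Implicit.
Unset Printing Implicit Defensive.

Import Order.TTheory GRing.Theory Num.Theory.
Import numFieldNormedType.Exports.

Local Open Scope classical_set_scope.
Local Open Scope ring_scope.

(** * Euclidean inner product and norm on row vectors *)

Section euclidean.
Context {R : realType} {d : nat}.
Implicit Types u v : 'rV[R]_d.

Definition dot u v : R := \sum_(j < d) u ord0 j * v ord0 j.

Lemma sqr_enorm v : enorm v ^+ 2 = dot v v.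
Proof.
rewrite sqr_sqrtr; last by apply: sumr_ge0 => j _; exact: sqr_ge0.
by apply: eq_bigr => j _; rewrite expr2.
Qed.

Lemma enorm_ge0 v : 0 <= enorm v.
Proof. exact: sqrtr_ge0. Qed.

Lemma dotDl u1 u2 v : dot (u1 + u2) v = dot u1 v + dot u2 v.
Proof. by rewrite -big_split; apply: eq_bigr => j _; rewrite mxE mulrDl. Qed.

Lemma dotZl a u v : dot (a *: u) v = a * dot u v.
Proof. by rewrite mulr_sumr; apply: eq_bigr => j _; rewrite mxE mulrA. Qed.

Lemma dotC u v : dot u v = dot v u.
Proof. by apply: eq_bigr => j _; rewrite mulrC. Qed.

Lemma dotDr u v1 v2 : dot u (v1 + v2) = dot u v1 + dot u v2.
Proof. by rewrite dotC dotDl !(dotC u). Qed.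

Lemma dotZr a u v : dot u (a *: v) = a * dot u v.
Proof. by rewrite dotC dotZl dotC. Qed.

Lemma enorm0_eq0 v : enorm v = 0 -> v = 0.
Proof.
move=> v0; apply/rowP => j; rewrite mxE.
move/eqP: (sqr_enorm v); rewrite v0 expr0n eq_sym psumr_eq0.
  by move/allP/(_ j); rewrite mem_index_enum /= mulf_eq0 orbb => /(_ isT)/eqP.
by move=> i _; rewrite -expr2 sqr_ge0.
Qed.

(** Cauchy-Schwarz: for nonzero vectors, expand the squared norm of [|v| u - |u| v], which is
    nonnegative, and divide by [|u| |v|]. *)
Lemma dot_le_enorm u v : dot u v <= enorm u * enorm v.
Proof.
have [/eqP/enorm0_eq0->|u0] := boolP (enorm u == 0).
  by rewrite -(scale0r 0) dotZl mul0r mulr_ge0 ?enorm_ge0.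
have [/eqP/enorm0_eq0->|v0] := boolP (enorm v == 0).
  by rewrite -(scale0r 0) dotZr mul0r mulr_ge0 ?enorm_ge0.
have up : 0 < enorm u by rewrite lt_neqAle eq_sym u0 enorm_ge0.
have vp : 0 < enorm v by rewrite lt_neqAle eq_sym v0 enorm_ge0.
have : 0 <= enorm (enorm v *: u + (- enorm u) *: v) ^+ 2 by exact: sqr_ge0.
rewrite sqr_enorm !dotDl !dotDr !dotZl !dotZr -!sqr_enorm (dotC v u) => H.
by rewrite -(ler_pM2l (mulr_gt0 vp up)); nra.
Qed.

Lemma enormZ s v : 0 <= s -> enorm (s *: v) = s * enorm v.
Proof.
move=> s0; apply/eqP; rewrite -(eqrXn2 (n:=2)) ?mulr_ge0 ?enorm_ge0//.
by rewrite exprMn !sqr_enorm dotZl dotZr; apply/eqP; ring.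
Qed.

(** Cauchy-Schwarz in the shape needed for descent: [u] will be the difference of the gradients at
    two points that differ by [s *: v]. *)
Lemma dot_le_lipschitz (L s : R) u v : 0 <= s ->
  enorm u <= L * enorm (s *: v) -> dot u v <= L * s * dot v v.
Proof.
move=> s0; rewrite enormZ// mulrA => uv.
apply: le_trans (dot_le_enorm u v) _.
by rewrite -sqr_enorm expr2 mulrA ler_wpM2r// enorm_ge0.
Qed.

End euclidean.

(** * Consequences of a Lipschitz gradient *)

Section smooth.
Context {R : realType} {d : nat}.
Variables (f : 'rV[R]_d -> R) (L : R).
Hypothesis f_diff : forall y, differentiable f y.
Hypothesis L_gt0 : 0 < L.
Hypothesis f_smooth : forall y z,
  enorm (grad f y - grad f z) <= L * enorm (y - z).

(** [grad] only collects the derivatives along the basis vectors; linearity of the differential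
    extends it to every direction. *)
Lemma derive_grad y v : 'D_v f y = dot (grad f y) v.
Proof.
rewrite deriveE// {1}(row_sum_delta v) linear_sum /=.
apply: eq_bigr => j _.
by rewrite linearZ /= !mxE deriveE// mulrC.
Qed.

Lemma is_derive_line y v (s : R) :
  is_derive s 1 (fun r : R => f (y + r *: v)) (dot (grad f (y + s *: v)) v).
Proof.
have E : (fun h : R => h^-1 *: (f (y + (h *: 1 + s) *: v) - f (y + s *: v))) =
         (fun h : R => h^-1 *: (f (h *: v + (y + s *: v)) - f (y + s *: v))).
  apply/funext => h; congr (_ *: (f _ - _)).
  by rewrite [h *: 1]mulr1 scalerDl addrCA.
have D := @diff_derivable _ _ _ f (y + s *: v) v (f_diff _).
apply: DeriveDef.
  by rewrite /derivable /= E.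
by rewrite -derive_grad /derive /= E.
Qed.

(** Along the segment, [psi] is [f] minus its quadratic model. Its derivative [dpsi] is nonpositive
    on [[0, 1]] by the Lipschitz bound, so the mean value theorem gives [psi 1 <= psi 0]. *)
Lemma descent y v :
  f (y + v) <= f y + dot (grad f y) v + L / 2 * dot v v.
Proof.
pose psi (s : R) := f (y + s *: v) - (s * dot (grad f y) v + L / 2 * s ^+ 2 * dot v v).
pose dpsi (s : R) := dot (grad f (y + s *: v)) v - (dot (grad f y) v + L * s * dot v v).
have dP (s : R) : is_derive s 1 psi (dpsi s).
  have H1 := is_derive_line y v s.
  have H2 : is_derive s 1 (fun s : R => s * dot (grad f y) v + L / 2 * s ^+ 2 * dot v v)
     (dot (grad f y) v + L * s * dot v v).
    by apply: is_derive_eq; rewrite /GRing.scale /=; field.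
  exact: is_deriveB.
have cP : {within `[(0:R), 1], continuous psi}.
  apply: derivable_within_continuous => s _; exact: ex_derive.
have [c + E] := MVT_segment (@ler01 R) (fun s _ => dP s) cP.
rewrite in_itv/= => /andP[c0 c1].
have : dpsi c <= 0.
  rewrite /dpsi opprD addrA subr_le0 -[leLHS]/(dot _ v - dot _ v).
  rewrite (_ : _ - _ = dot (grad f (y + c *: v) - grad f y) v); last first.
    by rewrite dotDl -(scaleN1r (grad f y)) dotZl mulN1r.
  apply: dot_le_lipschitz => //; apply: le_trans (f_smooth _ _) _.
  by rewrite addrC addKr.
move: E; rewrite subr0 mulr1 /psi scale1r scale0r addr0 => <-.
rewrite mul0r expr0n /= mulr0 mul0r addr0 subr0 !mul1r expr1n mulr1.
lra.
Qed.

(** A gradient step of length [1 / L] brings the descent bound down to [f y - |grad f y|^2 / (2 L)],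
    which still cannot lie below [fstar]. *)
Lemma grad_le_gap fstar y : (forall z, fstar <= f z) ->
  enorm (grad f y) ^+ 2 <= 2 * L * (f y - fstar).
Proof.
move=> fm; have := le_trans (fm _) (descent y (- L^-1 *: grad f y)).
rewrite scaleNr -(scaleN1r (_ *: grad f y)) !dotZr !dotZl -sqr_enorm; set q := enorm _ ^+ 2.
have -> : f y + -1 * (L^-1 * q) + L / 2 * (-1 * (L^-1 * (-1 * (L^-1 * q)))) = f y - q / (2 * L).
  by field; rewrite gt_eqF.
by rewrite lerBrDr addrC -lerBrDr ler_pdivrMr ?mulr_gt0// mulrC.
Qed.

(** The descent bound with [g] split into gradient and noise. The three resulting terms stay
    separate because expectation treats each differently: the cross term vanishes, and the noise
    term is controlled by the variance. *)
Lemma sgd_step_le fstar y g eta :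
  f (y - eta *: g) - fstar <= (f y - fstar)
    + (L / 2 * eta ^+ 2 - eta) * enorm (grad f y) ^+ 2
    + (L * eta ^+ 2 - eta) * dot (grad f y) (g - grad f y)
    + L / 2 * eta ^+ 2 * enorm (g - grad f y) ^+ 2.
Proof.
have := descent y (- eta *: g); rewrite scaleNr.
set h := grad f y; rewrite !sqr_enorm -scaleNr => H.
rewrite lerBlDr; apply: le_trans H _.
have -> : g = h + (g - h) by rewrite addrC subrK.
move: (g - h) => D; rewrite (_ : h + D - h = D); last by rewrite addrC addKr.
rewrite !dotZl !dotZr !dotDl !dotDr (dotC D h).
by rewrite le_eqVlt; apply/orP; left; apply/eqP; field.
Qed.

End smooth.

(** * Measurability of continuous functions of a random vector *)

Section measurable_rV.
Context d0 (T : measurableType d0) (R : realType) (d : nat).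

(* f o u is the limit of f applied to u with coordinates rounded down to
   multiples of 1/(k+1), which factors through a countable set. *)
Lemma measurable_continuous_rV (f : 'rV[R]_d -> R) (u : T -> 'rV[R]_d) :
  continuous f -> (forall j, measurable_fun setT (fun w => u w ord0 j)) ->
  measurable_fun setT (f \o u).
Proof.
move=> cf mu.
pose code (k : nat) w : {ffun 'I_d -> int} :=
  [ffun j => Num.floor (k.+1%:R * u w ord0 j)].
pose decode (k : nat) (v : {ffun 'I_d -> int}) : 'rV[R]_d :=
  \row_j ((v j)%:~R / k.+1%:R).
apply: (@measurable_fun_cvg _ _ _ _ (fun k w => f (decode k (code k w)))).
  move=> k _ B mB; rewrite setTI.
  rewrite (_ : _ @^-1` B = \bigcup_(v in [set v | B (f (decode k v))])
                           (code k @^-1` [set v])); last first.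
    apply/seteqP; split => [w Bw|w /= [v Bv] /= -> //].
    by exists (code k w).
  rewrite bigcup_mkcond; apply: countable_bigcupT_measurable; first exact: countableP.
  move=> v.
  case: ifP => _ //.
  rewrite (_ : _ @^-1` [set v] = \bigcap_(j in [set: 'I_d])
     ((fun w => u w ord0 j) @^-1`
        `[(v j)%:~R / k.+1%:R, (v j + 1)%:~R / k.+1%:R[)); last first.
    have kp : (0 : R) < k.+1%:R by [].
    apply/seteqP; split => w /=.
      move=> <- j _ /=; rewrite in_itv /= ffunE.
      rewrite ler_pdivrMr// ltr_pdivlMr// mulrC.
      by rewrite floor_le_tmp floorD1_gt.
    move=> H; apply/ffunP => j; rewrite ffunE.
    have := H j I; rewrite /= in_itv /= ler_pdivrMr// ltr_pdivlMr// mulrC.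
    by exact: floor_def.
  apply: fin_bigcap_measurable => // j _.
  by rewrite -[X in measurable X]setTI; apply: mu.
move=> w _.
suff : (fun k => decode k (code k w)) @ \oo --> u w.
  by move=> duw; exact: cvg_comp duw (cf (u w)).
apply/cvgrPdist_lt => e e0; near=> k.
have kp : (0 : R) < k.+1%:R by [].
rewrite [ltLHS]/Num.norm /= mx_normrE; apply/bigmax_ltP; split => //= -[i j] _ /=.
rewrite !mxE ffunE ord1.
set a := u w ord0 j.
have : (Num.floor (k.+1%:R * a))%:~R <= k.+1%:R * a < (Num.floor (k.+1%:R * a) + 1)%:~R.
  by rewrite floor_le_tmp floorD1_gt.
move: (Num.floor _) => z; rewrite intrD => /andP[z1 z2].
have -> : a - z%:~R / k.+1%:R = (k.+1%:R * a - z%:~R) / k.+1%:R.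
  by rewrite mulrBl (mulrAC _ a) divff ?mul1r// gt_eqF.
rewrite ger0_norm ?divr_ge0 ?subr_ge0// ltr_pdivrMr//.
(* In each coordinate, hence in the sup norm, rounding costs less than [1 / (k + 1)], so any [k]
   above [1 / e] works. *)
apply: (@lt_trans _ _ 1); first by rewrite ltrBlDl.
rewrite mulrC -ltr_pdivrMr // div1r.
rewrite -natr1; apply: ltr_wpDr => //; near: k.
exact: nbhs_infty_gtr.
Unshelve. all: by end_near. Qed.

End measurable_rV.

(** * Integrals weighted by a nonnegative random variable *)

Section weighted.
Local Open Scope ereal_scope.
Context d0 (T : measurableType d0) (R : realType).
Variable mu : {measure set T -> \bar R}.
Import HBNNSimple.

(* Composing simple functions on R with Y approximates Y using only the sets
   Y @^-1` B, so no measurable structure for a sub-sigma-algebra is needed. *)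
Lemma ge0_integral_weight_eq (D1 D2 : T -> R) (Y : T -> R) :
  measurable_fun setT D1 -> (forall w, 0 <= D1 w)%R ->
  measurable_fun setT D2 -> (forall w, 0 <= D2 w)%R ->
  measurable_fun setT Y -> (forall w, 0 <= Y w)%R ->
  (forall B, measurable B -> \int[mu]_(w in Y @^-1` B) (D1 w)%:E = \int[mu]_(w in Y @^-1` B) (D2 w)%:E) ->
  \int[mu]_w ((Y w)%:E * (D1 w)%:E) = \int[mu]_w ((Y w)%:E * (D2 w)%:E).
Proof.
move=> mD1 D10 mD2 D20 mY Y0 H.
have mid : measurable_fun setT (EFin : R -> \bar R).
  by apply/measurable_EFinP; exact: measurable_id.
(* The functions [h n] increase to the positive part of the identity on the real line, which is the
   identity on the values of [Y]. *)
pose mp := measurable_funepos mid.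
pose h := nnsfun_approx (@measurableT _ R) mp.
have hcvg y : (0 <= y)%R -> EFin \o h ^~ y @ \oo --> y%:E.
  move=> y0; have := @cvg_nnsfun_approx _ _ _ _ measurableT _ mp (fun x _ => funepos_ge0 _ x) y I.
  by rewrite funeposE max_l ?lee_fin.
have mh n : measurable_fun setT (fun w => (h n (Y w))%:E).
  by apply/measurable_EFinP; apply: measurableT_comp => //.
have limE (D : T -> R) : measurable_fun setT D -> (forall w, 0 <= D w)%R ->
    \int[mu]_w ((Y w)%:E * (D w)%:E) = limn (fun n => \int[mu]_w ((h n (Y w))%:E * (D w)%:E)).
  move=> mD D0.
  have mDE : measurable_fun setT (EFin \o D) by exact/measurable_EFinP.
  rewrite -monotone_convergence //.
  - apply: eq_integral => w _; apply/esym/cvg_lim => //.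
    by apply: cvgeZr => //; exact: hcvg.
  - by move=> n; exact: emeasurable_funM.
  - by move=> n w _; rewrite mule_ge0 ?lee_fin.
  - move=> w _ a b ab; apply: lee_wpmul2r; first by rewrite lee_fin.
    by rewrite lee_fin; exact/lefP/nd_nnsfun_approx.
rewrite !limE//; congr (limn _); apply/funext => n.
have simpleE (D : T -> R) : measurable_fun setT D -> (forall w, 0 <= D w)%R ->
    \int[mu]_w ((h n (Y w))%:E * (D w)%:E) =
    \sum_(r \in range (h n)) (r%:E * \int[mu]_(w in Y @^-1` (h n @^-1` [set r])) (D w)%:E).
  move=> mD D0.
  have mDE : measurable_fun setT (EFin \o D) by exact/measurable_EFinP.
  have mA r : measurable (Y @^-1` (h n @^-1` [set r])).
    by rewrite -[X in measurable X]setTI; apply: mY.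
  transitivity (\int[mu]_w (\sum_(r \in range (h n)) (r * \1_(h n @^-1` [set r]) (Y w))%:E * (D w)%:E)).
    apply: eq_integral => w _; rewrite fimfunE -fsumEFin//.
    by rewrite ge0_mule_fsuml// => r; exact: nnfun_muleindic_ge0.
  rewrite ge0_integral_fsum//; last 2 first.
  - move=> r; apply: emeasurable_funM => //; apply/measurable_EFinP.
    by apply: measurable_funM => //; apply: measurableT_comp.
  - by move=> r w _; rewrite mule_ge0// ?lee_fin// -lee_fin EFinM nnfun_muleindic_ge0.
  apply: eq_fsbigr => r /set_mem [y _ yr].
  under eq_integral do rewrite EFinM -muleA.
  have r0 : (0 <= r)%R by rewrite -yr.
  rewrite ge0_integralZl_EFin//; last 2 first.
  - by move=> w _; rewrite mule_ge0// lee_fin.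
  - apply: emeasurable_funM => //; apply/measurable_EFinP.
    exact: measurableT_comp.
  congr (_ * _); rewrite [RHS]integral_mkcond; apply: eq_integral => w _.
  have E : (Y w \in h n @^-1` [set r]) = (w \in Y @^-1` (h n @^-1` [set r])).
    by apply/idP/idP => /set_mem ?; exact/mem_set.
  by rewrite /patch indicE E; case: ifP => _; rewrite ?mul1e ?mul0e.
rewrite !simpleE//; apply: eq_fsbigr => r _; congr (_ * _).
by apply: H; rewrite -[X in measurable X]setTI; exact: measurable_funP.
Qed.

End weighted.

(** * Orthogonality to noise of zero conditional mean *)

Section pull_out.
Context d0 (T : measurableType d0) (R : realType).
Variable mu : {measure set T -> \bar R}.

(** Split [D] into positive and negative parts. By assumption they have equal integrals over every
    preimage under [Y], hence equal integrals when weighted by [Y]; all four functions are dominated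
    by [|D|] or [|Y D|], so the subtraction is legitimate. *)
Let ge0_integral_mul_eq0 (D Y : T -> R) :
  mu.-integrable setT (EFin \o D) -> measurable_fun setT Y ->
  (forall w, 0 <= Y w) -> mu.-integrable setT (EFin \o (Y \* D)) ->
  (forall B, measurable B -> (\int[mu]_(w in Y @^-1` B) (D w)%:E = 0)%E) ->
  (\int[mu]_w (Y w * D w)%:E = 0)%E.
Proof.
move=> iD mY Y0 iYD H.
have mD : measurable_fun setT D by apply/measurable_EFinP; exact: measurable_int iD.
pose Dp w := Num.max (D w) 0; pose Dn w := Num.max (- D w) 0.
have mDp : measurable_fun setT Dp by exact: measurable_maxr.
have mDn : measurable_fun setT Dn by apply: measurable_maxr => //; exact: measurable_funN.
have DE w : D w = Dp w - Dn w.
  by rewrite /Dp /Dn /Num.max; do 2 case: ifP; lra.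
have Dp0 w : 0 <= Dp w by rewrite le_max lexx orbT.
have Dn0 w : 0 <= Dn w by rewrite le_max lexx orbT.
have DpD w : Dp w <= `|D w| by rewrite ge_max ler_norm normr_ge0.
have DnD w : Dn w <= `|D w| by rewrite ge_max -normrN ler_norm normr_ge0.
have iDp : mu.-integrable setT (EFin \o Dp).
  apply: le_integrable iD => //; first exact/measurable_EFinP.
  by move=> w _ /=; rewrite lee_fin ger0_norm.
have iDn : mu.-integrable setT (EFin \o Dn).
  apply: le_integrable iD => //; first exact/measurable_EFinP.
  by move=> w _ /=; rewrite lee_fin ger0_norm.
have iYDp : mu.-integrable setT (EFin \o (Y \* Dp)).
  apply: le_integrable iYD => //; first by apply/measurable_EFinP; exact: measurable_funM.
  move=> w _ /=; rewrite lee_fin ger0_norm ?mulr_ge0// normrM ger0_norm//.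
  by rewrite ler_wpM2l.
have iYDn : mu.-integrable setT (EFin \o (Y \* Dn)).
  apply: le_integrable iYD => //; first by apply/measurable_EFinP; exact: measurable_funM.
  move=> w _ /=; rewrite lee_fin ger0_norm ?mulr_ge0// normrM ger0_norm//.
  by rewrite ler_wpM2l.
under eq_integral do rewrite DE mulrBr.
rewrite integralB_EFin//.
have -> : (\int[mu]_w (Y w * Dp w)%:E = \int[mu]_w (Y w * Dn w)%:E)%E.
  under eq_integral do rewrite EFinM.
  under [RHS]eq_integral do rewrite EFinM.
  apply: ge0_integral_weight_eq => // B mB.
  have mYB : measurable (Y @^-1` B) by rewrite -[X in measurable X]setTI; exact: mY.
  have := H _ mB; under eq_integral do rewrite DE.
  rewrite integralB_EFin//; [|exact: integrableS iDp|exact: integrableS iDn].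
  by move/eqP; rewrite sube_eq ?add0e; [move/eqP| |];
    rewrite ?fin_num_adde_defl//; apply: integrable_fin_num => //; 
    [exact: integrableS iDp|exact: integrableS iDn].
by rewrite subee// integrable_fin_num.
Qed.

(** Reduction to a nonnegative factor: the positive and negative parts of [Y] are functions of [Y],
    so their preimages are again preimages under [Y]. *)
Lemma integral_mul_eq0 (D Y : T -> R) :
  mu.-integrable setT (EFin \o D) -> measurable_fun setT Y ->
  mu.-integrable setT (EFin \o (Y \* D)) ->
  (forall B, measurable B -> (\int[mu]_(w in Y @^-1` B) (D w)%:E = 0)%E) ->
  (\int[mu]_w (Y w * D w)%:E = 0)%E.
Proof.
move=> iD mY iYD H.
have mD : measurable_fun setT D by apply/measurable_EFinP; exact: measurable_int iD.
pose pos (y : R) := Num.max y 0; pose neg (y : R) := Num.max (- y) 0.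
have mpos : measurable_fun setT pos by exact: measurable_maxr.
have mneg : measurable_fun setT neg by apply: measurable_maxr => //; exact: measurable_funN.
have part (p : R -> R) : measurable_fun setT p -> (forall y, 0 <= p y <= `|y|) ->
    mu.-integrable setT (EFin \o ((p \o Y) \* D)) /\
    (\int[mu]_w (p (Y w) * D w)%:E = 0)%E.
  move=> mp p0.
  have mpY : measurable_fun setT (p \o Y) by exact: measurableT_comp.
  have ipD : mu.-integrable setT (EFin \o ((p \o Y) \* D)).
    apply: le_integrable iYD => //; first by apply/measurable_EFinP; exact: measurable_funM.
    move=> w _ /=; have /andP[a b] := p0 (Y w).
    by rewrite lee_fin !normrM ler_wpM2r// ger0_norm.
  split=> //; apply: (@ge0_integral_mul_eq0 D (p \o Y)) => //.
    by move=> w /=; have /andP[] := p0 (Y w).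
  move=> B mB; rewrite comp_preimage; apply: H.
  by rewrite -[X in measurable X]setTI; exact: mp.
have posP y : 0 <= pos y <= `|y|.
  by rewrite le_max lexx orbT ge_max ler_norm normr_ge0.
have negP y : 0 <= neg y <= `|y|.
  by rewrite le_max lexx orbT ge_max -normrN ler_norm normr_ge0.
have [[ip Ip] [iq Iq]] := (part pos mpos posP, part neg mneg negP).
have YE w : Y w * D w = pos (Y w) * D w - neg (Y w) * D w.
  by rewrite -mulrBl; congr (_ * _); rewrite /pos /neg /Num.max; do 2 case: ifP; lra.
under eq_integral do rewrite YE.
by rewrite integralB_EFin// Ip Iq subee.
Qed.

End pull_out.

Lemma measurable_wrt_EFin dO (Omega : measurableType dO) (R : realType)
    (F : set (set Omega)) (u : Omega -> R) :
  measurable_wrt F (fun w => (u w)%:E) -> measurable_wrt F u.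
Proof.
move=> mu B mB; have := mu _ (measurable_image_EFin mB).
rewrite (_ : _ @^-1` (EFin @` B) = u @^-1` B)//.
by apply/seteqP; split => w /= => [[r Br [<-]]//|Bw]; exists (u w).
Qed.

(** * One SGD query in expectation *)

Section step.
Context dO (Omega : measurableType dO) (R : realType) (d : nat).
Variable P : probability Omega R.
Variables (f : 'rV[R]_d -> R) (L fstar rho sigma : R).
Hypothesis f_diff : forall y, differentiable f y.
Hypothesis L_gt0 : 0 < L.
Hypothesis f_smooth : forall y z,
  enorm (grad f y - grad f z) <= L * enorm (y - z).
Hypothesis f_ge : forall y, fstar <= f y.
Hypotheses (rho_ge0 : 0 <= rho) (sigma_ge0 : 0 <= sigma).
Variables (F : set (set Omega)) (y g : Omega -> 'rV[R]_d).
Hypothesis F_measurable : F `<=` measurable.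
Hypothesis F_setT : F setT.
Hypothesis y_measurable : forall j, measurable_fun setT (fun w => y w ord0 j).
Hypothesis g_measurable : forall j, measurable_fun setT (fun w => g w ord0 j).
Hypothesis unbiased : forall j : 'I_d, is_cond_exp P F
  (fun w => (g w ord0 j)%:E) (fun w => (grad f (y w) ord0 j)%:E).
Hypothesis variance : cond_exp_le P F
  (fun w => (enorm (g w - grad f (y w)) ^+ 2)%:E)
  (fun w => (rho * enorm (grad f (y w)) ^+ 2 + sigma)%:E).
Hypothesis gap_int : P.-integrable setT (fun w => (f (y w) - fstar)%:E).

Local Notation h w := (grad f (y w)).
Local Notation L1 u := (P.-integrable setT (fun w => (u w)%:E)).

(** Unbiasedness exhibits the gradient as a version of a conditional expectation, which includes its
    [F]-measurability. *)
Let mh_F j B : measurable B -> F ((fun w => h w ord0 j) @^-1` B).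
Proof. by have [_ _ mZ _] := unbiased j; exact: measurable_wrt_EFin. Qed.

Let mh j : measurable_fun setT (fun w => h w ord0 j).
Proof. by move=> _ B mB; rewrite setTI; apply: F_measurable; exact: mh_F. Qed.

Let int_le (u v : Omega -> R) : measurable_fun setT u -> L1 v ->
  (forall w, `|u w| <= v w) -> L1 u.
Proof.
move=> mu iv uv; apply: le_integrable iv => //; first exact/measurable_EFinP.
by move=> w _ /=; rewrite lee_fin (le_trans (uv w))// ler_norm.
Qed.

Let intD (u v : Omega -> R) : L1 u -> L1 v -> L1 (fun w => u w + v w).
Proof. by move=> iu iv; exact: (integrableD measurableT iu iv). Qed.

Let intZ k (u : Omega -> R) : L1 u -> L1 (fun w => k * u w).
Proof. by move=> iu; exact: (integrableZl measurableT k iu). Qed.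

Let intC k : L1 (fun=> k).
Proof. exact: finite_measure_integrable_cst. Qed.

Let subE (u v : 'rV[R]_d) j : (u - v) ord0 j = u ord0 j - v ord0 j.
Proof. by rewrite !mxE. Qed.

Lemma grad_sqr_integrable : L1 (fun w => enorm (h w) ^+ 2).
Proof.
apply: (int_le _ (intZ (2 * L) gap_int)) => [|w]; last first.
  by rewrite ger0_norm ?sqr_ge0// (grad_le_gap f_diff).
under eq_fun do rewrite sqr_enorm.
by apply: measurable_sum => j; exact: measurable_funM.
Qed.

(** The conditional bound is tested on the whole space. Its right side is integrable, so the same
    inequality yields integrability of the squared noise. *)
Lemma noise_sqr_integrable_le : L1 (fun w => enorm (g w - h w) ^+ 2) /\
  \int[P]_w (enorm (g w - h w) ^+ 2) <= rho * \int[P]_w (enorm (h w) ^+ 2) + sigma.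
Proof.
have iQ := grad_sqr_integrable.
have [Z [mE _ mZ EZ] Zle] := variance.
have iB : L1 (fun w => rho * enorm (h w) ^+ 2 + sigma) by exact: intD (intZ _ iQ) (intC _).
have mZ' : measurable_fun setT Z.
  by move=> _ B mB; rewrite setTI; apply: F_measurable; exact: mZ.
have le : (\int[P]_w (enorm (g w - h w) ^+ 2)%:E <=
           \int[P]_w (rho * enorm (h w) ^+ 2 + sigma)%:E)%E.
  (* [Z] may take negative values, so the comparison passes through its positive part, which is
     still almost surely below the nonnegative bound. *)
  rewrite EZ//; apply: (@le_trans _ _ (\int[P]_w (Z^\+ w))%E).
    by rewrite integralE -[leRHS]sube0 leeB// integral_ge0.
  apply: ae_ge0_le_integral => //.
  - exact: measurable_funepos.
  - by move=> w _; rewrite lee_fin addr_ge0// mulr_ge0// sqr_ge0.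
  - exact: measurable_int iB.
  - apply: filterS Zle => w Zw _; rewrite funeposE ge_max Zw /=.
    by rewrite lee_fin addr_ge0// mulr_ge0// sqr_ge0.
have iE : L1 (fun w => enorm (g w - h w) ^+ 2).
  apply/integrableP; split => //.
  under eq_integral do rewrite /= ger0_norm ?sqr_ge0//.
  by apply: (le_lt_trans le); rewrite ltey_eq integrable_fin_num.
split => //.
rewrite -(@RintegralZl _ _ _ P)// -[in leRHS](mulr1 sigma).
have -> : sigma * 1 = \int[P]_w sigma.
  rewrite Rintegral_cst//; congr (_ * _). by rewrite -[1]/(fine 1%E) -(@probability_setT _ _ _ P).
rewrite -RintegralD//; [|exact: intZ|exact: intC].
by rewrite -lee_fin !fineK// integrable_fin_num.
Qed.

(** Orthogonality is proved one coordinate at a time. Integrability comes from [a <= a^2 + 1] for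
    single coordinates and [a b <= a^2 + b^2] for products. *)
Lemma noise_cross_integrable_eq0 : L1 (fun w => dot (h w) (g w - h w)) /\
  \int[P]_w dot (h w) (g w - h w) = 0.
Proof.
have iQ := grad_sqr_integrable.
have [iE _] := noise_sqr_integrable_le.
have coord (v : 'rV[R]_d) j : `|v ord0 j| ^+ 2 <= enorm v ^+ 2.
  rewrite sqr_enorm /dot (bigD1 j)//= -normrX ger0_norm ?sqr_ge0// expr2 lerDl.
  by apply: sumr_ge0 => k _; rewrite -expr2 sqr_ge0.
have mD j : measurable_fun setT (fun w => (g w - h w) ord0 j).
  by under eq_fun do rewrite subE; exact: measurable_funB.
have iD j : L1 (fun w => (g w - h w) ord0 j).
  apply: (int_le _ (intD iE (intC 1))) => // w.
  have := coord (g w - h w) j; set a := `|_|; nra.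
have ih j : L1 (fun w => h w ord0 j).
  apply: (int_le _ (intD iQ (intC 1))) => // w.
  have := coord (h w) j; set a := `|_|; nra.
have ig j : L1 (fun w => g w ord0 j).
  have := intD (iD j) (ih j); congr (integrable _ _ _).
  by apply/funext => w; rewrite subE subrK.
have ihD j : L1 (fun w => h w ord0 j * (g w - h w) ord0 j).
  apply: (int_le _ (intD iQ iE)) => [|w]; first exact: measurable_funM.
  have := coord (h w) j; have := coord (g w - h w) j.
  rewrite normrM; set a := `|_|; set b := `|_|; nra.
(* Preimages under a gradient coordinate belong to [F], and over such sets unbiasedness makes the
   noise coordinate integrate to zero. *)
have ihD0 j : (\int[P]_w (h w ord0 j * (g w - h w) ord0 j)%:E = 0)%E.
  apply: (integral_mul_eq0 (iD j) (mh j) (ihD j)) => B mB.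
  have FB := mh_F j mB; have mFB := F_measurable FB.
  under eq_integral do rewrite subE EFinB.
  rewrite integralB_EFin//; [|exact: integrableS (ig j)|exact: integrableS (ih j)].
  have [_ _ _ ->//] := unbiased j.
  by rewrite subee// integrable_fin_num//; exact: integrableS (ih j).
have E w : (dot (h w) (g w - h w))%:E =
    \sum_(j < d) (h w ord0 j * (g w - h w) ord0 j)%:E by rewrite sumEFin.
split.
  under eq_fun do rewrite E.
  by apply: integrable_sum.
rewrite /Rintegral; under eq_integral do rewrite E.
by rewrite integral_sum//= big1.
Qed.

Lemma expected_step eta : 0 < eta -> eta <= 1 / ((rho + 1) * L) ->
  L1 (fun w => f (y w - eta *: g w) - fstar) /\
  eta * \int[P]_w (enorm (h w) ^+ 2) <=
    2 * (\int[P]_w (f (y w) - fstar) - \int[P]_w (f (y w - eta *: g w) - fstar))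
    + L * eta ^+ 2 * sigma.
Proof.
move=> eta0 etale.
have iQ := grad_sqr_integrable.
have [iE Ele] := noise_sqr_integrable_le.
have [iC C0] := noise_cross_integrable_eq0.
have i1 := intD gap_int (intZ (L / 2 * eta ^+ 2 - eta) iQ).
have i2 := intD i1 (intZ (L * eta ^+ 2 - eta) iC).
have i3 := intD i2 (intZ (L / 2 * eta ^+ 2) iE).
have mf : measurable_fun setT (fun w => f (y w - eta *: g w) - fstar).
  apply: measurable_funB => //.
  apply: (@measurable_continuous_rV _ _ _ _ f (fun w => y w - eta *: g w)).
    by move=> z; exact: differentiable_continuous.
  move=> j; under eq_fun do rewrite subE mxE.
  by apply: measurable_funB => //; exact: measurable_funM.
have le w : f (y w - eta *: g w) - fstar <= _ :=
  sgd_step_le f_diff f_smooth fstar (y w) (g w) eta.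
(* The new gap is nonnegative and lies below an integrable bound. *)
have i0 : L1 (fun w => f (y w - eta *: g w) - fstar).
  by apply: (int_le mf i3) => w; rewrite ger0_norm ?subr_ge0.
split => //.
have := le_Rintegral measurableT i0 i3 (fun w _ => le w).
rewrite (RintegralD measurableT i2 (intZ _ iE)) (RintegralD measurableT i1 (intZ _ iC)).
rewrite (RintegralD measurableT gap_int (intZ _ iQ)).
rewrite !RintegralZl// C0 mulr0 addr0.
have Q0 : 0 <= \int[P]_w (enorm (h w) ^+ 2) by apply: Rintegral_ge0 => w _; exact: sqr_ge0.
move: Q0 Ele; move: (\int[P]_w (enorm (h w) ^+ 2)) => Q Q0.
move: (\int[P]_w (enorm (g w - h w) ^+ 2)) => E Ele.
(* [e1] inserts the variance bound. The coefficient of [Q] is then [L eta^2 (rho + 1) - 2 eta], and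
   by [e2] the first term costs at most [eta], which leaves [- eta]. *)
have K1 : eta * ((rho + 1) * L) <= 1.
  by rewrite -ler_pdivlMr// mulr_gt0// ltr_wpDl.
have e1 : L * eta ^+ 2 * E <= L * eta ^+ 2 * (rho * Q + sigma).
  by rewrite ler_wpM2l// mulr_ge0 ?sqr_ge0// ltW.
have e2 : eta * Q * (eta * ((rho + 1) * L)) <= eta * Q * 1.
  by rewrite ler_wpM2l// mulr_ge0// ltW.
nra.
Qed.

End step.

(** * The filtration generated by the run *)

Section history.
Context dO (Omega : measurableType dO) dX (X : measurableType dX).
Variables (N : nat) (Sl : nat -> nat) (xi : nat -> nat -> Omega -> X).
Local Notation H := (history N Sl xi).

Lemma history_measurable t i :
  (forall s j, query N Sl s j -> measurable_fun setT (xi s j)) ->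
  H t i `<=` measurable.
Proof.
move=> mxi; apply: smallest_sub; first exact: sigma_algebra_measurable.
move=> A [s [j [qsj _ [B mB ->]]]].
by rewrite -[X in measurable X]setTI; exact: mxi.
Qed.

Lemma history_setT t i : H t i setT.
Proof.
have [h0 hD _] := smallest_sigma_algebra setT
  [set A | exists s j, [/\ query N Sl s j, before s j t i &
                 exists2 B, measurable B & A = xi s j @^-1` B] ].
by have := hD _ h0; rewrite setD0.
Qed.

Lemma history_subset_run t i : query N Sl t i -> H t i `<=` H N.+1 1.
Proof.
move=> [/andP[_ tN] _]; apply: sub_sigma_algebra2 => A [s [j [q b e]]].
exists s, j; split=> //; left; case: q => /andP[_ sN] _.
by rewrite ltnS.
Qed.

(** Viewing the history as the measurable structure of a generated sigma-algebra type lets the usual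
    closure rules for measurable functions apply to it. *)
Lemma history_enorm_sqr (R : realType) d (h : Omega -> 'rV[R]_d) t i :
  (forall j, measurable_wrt (H t i) (fun w => h w ord0 j)) ->
  measurable_wrt (H t i) (fun w => enorm (h w) ^+ 2).
Proof.
move=> mh; pose G := [set A | exists s j, [/\ query N Sl s j, before s j t i &
                 exists2 B, measurable B & A = xi s j @^-1` B] ].
suff m : measurable_fun (setT : set (g_sigma_algebraType G))
    (fun w : g_sigma_algebraType G => enorm (h w) ^+ 2).
  by move=> B mB; have := m measurableT B mB; rewrite setTI.
under eq_fun do rewrite sqr_enorm.
have mj j : measurable_fun (setT : set (g_sigma_algebraType G))
    (fun w : g_sigma_algebraType G => h w ord0 j).
  by move=> _ B mB; rewrite setTI; exact: mh.
by apply: measurable_sum => j; exact: measurable_funM.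
Qed.

End history.

(** * Expectation at an independently drawn index *)

Section output.
Context dO (Omega : measurableType dO) (R : realType).
Variable P : probability Omega R.

(** Independence says that the weights [\1_I] and the constant [P I] have the same integral over
    each preimage under [Y], so [ge0_integral_weight_eq] exchanges them. *)
Lemma expectation_indep (F : set (set Omega)) (I : set Omega) (Y : Omega -> R) :
  F `<=` measurable -> measurable I -> measurable_wrt F Y -> (forall w, 0 <= Y w) ->
  (forall A, F A -> P (A `&` I) = (P A * P I)%E) ->
  (\int[P]_w (Y w * \1_I w)%:E = P I * \int[P]_w (Y w)%:E)%E.
Proof.
move=> Fm mI mY Y0 ind.
have mY' : measurable_fun setT Y.
  by move=> _ B mB; rewrite setTI; apply: Fm; exact: mY.
have PIfin : P I \is a fin_num by exact: fin_num_measure.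
have c0 (w : Omega) : 0 <= cst (fine (P I)) w by exact: fine_ge0.
under eq_integral do rewrite EFinM.
rewrite (@ge0_integral_weight_eq _ _ _ P (\1_I) (cst (fine (P I))) Y)//; last first.
  move=> B mB; have FB := mY _ mB; have mFB := Fm _ FB.
  rewrite integral_indic// setIC; apply: (etrans (ind _ FB)).
  rewrite muleC -[in LHS](fineK PIfin).
  by rewrite -integral_cst.
under eq_integral do rewrite muleC.
rewrite ge0_integralZl_EFin ?fineK//.
- by move=> w _; rewrite lee_fin.
- exact/measurable_EFinP.
- exact: fine_ge0.
Qed.

(** The events fixing both indices partition the space, so the value at the random index is a finite
    sum of products with indicators, each factored by independence. Ordinals start at 0 and indices
    at 1, hence the shifts. *)
Lemma expectation_output (F : set (set Omega)) (N S : nat)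
    (Y : nat -> nat -> Omega -> R) (tstar istar : Omega -> nat) :
  F `<=` measurable ->
  (forall w, (1 <= tstar w <= N)%N /\ (1 <= istar w <= S)%N) ->
  measurable_fun setT tstar -> measurable_fun setT istar ->
  (forall t i, (1 <= t <= N)%N -> (1 <= i <= S)%N -> measurable_wrt F (Y t i)) ->
  (forall t i w, 0 <= Y t i w) ->
  (forall A, F A -> forall t i,
    P (A `&` [set w | tstar w = t /\ istar w = i]) =
    (P A * P [set w | tstar w = t /\ istar w = i])%E) ->
  (\int[P]_w (Y (tstar w) (istar w) w)%:E =
   \sum_(t < N) \sum_(i < S) (P [set w | tstar w = t.+1 /\ istar w = i.+1] *
      \int[P]_w (Y t.+1 i.+1 w)%:E))%E.
Proof.
move=> Fm rng mt mi mY Y0 ind.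
pose I (t i : nat) := [set w | tstar w = t /\ istar w = i].
have mI t i : measurable (I t i).
  rewrite (_ : I t i = (setT `&` tstar @^-1` [set t]) `&` (setT `&` istar @^-1` [set i])); last first.
    by apply/seteqP; split => w /=; rewrite /I /=; tauto.
  by apply: measurableI; [exact: mt|exact: mi].
have mY' t i : (1 <= t <= N)%N -> (1 <= i <= S)%N -> measurable_fun setT (Y t i).
  by move=> ht hi _ B mB; rewrite setTI; apply: Fm; exact: mY.
have E w : (Y (tstar w) (istar w) w)%:E =
    (\sum_(t < N) \sum_(i < S) (Y t.+1 i.+1 w * \1_(I t.+1 i.+1) w)%:E)%E.
  have [/andP[t1 tN] /andP[i1 iS]] := rng w.
  have tN' : ((tstar w).-1 < N)%N by rewrite prednK.
  have iS' : ((istar w).-1 < S)%N by rewrite prednK.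
  rewrite (bigD1 (Ordinal tN'))//= [X in (_ + X)%E]big1 ?adde0; last first.
    move=> t tn; apply: big1 => i _; rewrite indicE memNset ?mulr0// => -[tw _].
    by move/eqP: tn; apply; apply/val_inj; rewrite /= tw.
  rewrite (bigD1 (Ordinal iS'))//= [X in (_ + X)%E]big1 ?adde0; last first.
    move=> i in_; rewrite indicE memNset ?mulr0// => -[_ iw].
    by move/eqP: in_; apply; apply/val_inj; rewrite /= iw.
  by rewrite !prednK// indicE mem_set ?mulr1.
under eq_integral do rewrite E.
rewrite ge0_integral_sum//; last 2 first.
- move=> t; apply: emeasurable_sum => i; apply/measurable_EFinP.
  by apply: measurable_funM => //; apply: mY'; rewrite /= ltn_ord.
- by move=> t w _; apply: sume_ge0 => i _; rewrite lee_fin mulr_ge0.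
apply: eq_bigr => t _; rewrite ge0_integral_sum//; last 2 first.
- move=> i; apply/measurable_EFinP.
  by apply: measurable_funM => //; apply: mY'; rewrite /= ltn_ord.
- by move=> i w _; rewrite lee_fin mulr_ge0.
apply: eq_bigr => i _; apply: (expectation_indep Fm) => //.
  by apply: mY; rewrite /= ltn_ord.
by move=> A FA; exact: ind.
Qed.

End output.

(** * Two finite sums: square roots and summation by parts *)

Section sums.
Context {R : realType}.

(* The induction step is [0 <= (b - a)^2 (b + 2 a)] for [a = sqrt N] and
   [b = sqrt (N + 1)], where [b^2 - a^2 = 1]. *)
Lemma sum_sqrt_ge N :
  2 * N%:R * Num.sqrt N%:R <= 3 * \sum_(t < N) Num.sqrt (t.+1%:R : R).
Proof.
elim: N => [|N IH]; first by rewrite big_ord0 mulr0 mul0r mulr0.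
rewrite big_ord_recr /= mulrDr; apply: le_trans (lerD IH (lexx _)).
have : (Num.sqrt (N%:R : R)) ^+ 2 = N%:R by rewrite sqr_sqrtr.
have : (Num.sqrt (N.+1%:R : R)) ^+ 2 = N%:R + 1 by rewrite sqr_sqrtr -?natr1.
have : 0 <= Num.sqrt (N%:R : R) by exact: sqrtr_ge0.
have : 0 <= Num.sqrt (N.+1%:R : R) by exact: sqrtr_ge0.
move: (Num.sqrt N.+1%:R) (Num.sqrt N%:R) => b a b0 a0 bE aE.
rewrite -natr1.
have : 0 <= (b - a) ^+ 2 * (b + 2 * a) by rewrite mulr_ge0 ?sqr_ge0// addr_ge0// mulr_ge0.
have -> : (b - a) ^+ 2 * (b + 2 * a) = b * b ^+ 2 - 3 * b * a ^+ 2 + 2 * a * a ^+ 2 by ring.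
rewrite bE aE; lra.
Qed.

Lemma sum_by_parts (a : nat -> R) N :
  \sum_(t < N) t.+1%:R * (a t.+1 - a t.+2) = \sum_(t < N) a t.+1 - N%:R * a N.+1.
Proof.
elim: N => [|N IH]; first by rewrite !big_ord0 mul0r subrr.
by rewrite !big_ord_recr /= IH -natr1; ring.
Qed.

End sums.

(** * Propagation along the queries and stages *)

Section run.
Context dO (Omega : measurableType dO) (R : realType) (d : nat).
Variable P : probability Omega R.
Context dX (X : measurableType dX).
Variables (f : 'rV[R]_d -> R) (L fstar rho sigma : R).
Hypothesis f_diff : forall y, differentiable f y.
Hypothesis L_gt0 : 0 < L.
Hypothesis f_smooth : forall y z,
  enorm (grad f y - grad f z) <= L * enorm (y - z).
Hypothesis f_ge : forall y, fstar <= f y.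
Hypotheses (rho_ge0 : 0 <= rho) (sigma_ge0 : 0 <= sigma).
Variables (N : nat) (Sl : nat -> nat) (eta : nat -> nat -> R) (x11 : 'rV[R]_d).
Variables (xi : nat -> nat -> Omega -> X) (g x : nat -> nat -> Omega -> 'rV[R]_d).
Hypothesis iterates : sgd_iterates N Sl eta x11 g x.
Hypothesis oracle : stochastic_oracle N Sl xi g.
Hypothesis unbiased : unbiased_oracle P N Sl xi f g x.
Hypothesis variance : bounded_variance_oracle P N Sl xi f rho sigma g x.
Hypothesis eta_gt0 : forall t i, query N Sl t i -> 0 < eta t i.
Hypothesis eta_le : forall t i, query N Sl t i -> eta t i <= 1 / ((rho + 1) * L).

Definition mean_gap t i := \int[P]_w (f (x t i w) - fstar).
Definition mean_grad_sqr t i := \int[P]_w (enorm (grad f (x t i w)) ^+ 2).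

(** The invariant of the run: what the analysis of one query requires of the current iterate. *)
Definition regular_iterate t i :=
  (forall j, measurable_fun setT (fun w => x t i w ord0 j)) /\
  P.-integrable setT (fun w => (f (x t i w) - fstar)%:E).

Lemma query_step t i : query N Sl t i -> regular_iterate t i ->
  regular_iterate t i.+1 /\
  eta t i * mean_grad_sqr t i <=
    2 * (mean_gap t i - mean_gap t i.+1) + L * eta t i ^+ 2 * sigma.
Proof.
move=> q [mx ix].
have Hm := history_measurable (oracle_random oracle).
have mg j : measurable_fun setT (fun w => g t i w ord0 j).
  by move=> _ B mB; rewrite setTI; apply: (Hm t i.+1); exact: (oracle_adapted oracle q).
have E : x t i.+1 = (fun w => x t i w - eta t i *: g t i w).
  by apply/funext => w; exact: (iter_step iterates q).
have [i1 le] := expected_step f_diff L_gt0 f_smooth f_ge rho_ge0 sigma_ge0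
  (Hm t i) (@history_setT _ _ _ _ N Sl xi t i) mx mg (unbiased q) (variance q) ix
  (eta_gt0 q) (eta_le q).
split; last by rewrite /mean_gap E.
split; rewrite E// => j.
under eq_fun do rewrite !mxE.
by apply: measurable_funB => //; exact: measurable_funM.
Qed.

(** Each query both uses and restores the invariant, so regularity and the telescoped bound are
    proved in a single induction. After [k] queries the iterate has index [k + 1]. *)
Lemma stage_prefix t k : (1 <= t <= N)%N -> regular_iterate t 1 -> (k <= Sl t)%N ->
  regular_iterate t k.+1 /\
  \sum_(i < k) eta t i.+1 * mean_grad_sqr t i.+1 <=
    2 * (mean_gap t 1 - mean_gap t k.+1) + L * sigma * \sum_(i < k) eta t i.+1 ^+ 2.
Proof.
move=> ht r1; elim: k => [|k IH] kS.
  by rewrite !big_ord0 subrr !mulr0 addr0.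
have [rk lek] := IH (ltnW kS).
have q : query N Sl t k.+1 by [].
have [rk1 le] := query_step q rk; split=> //.
by rewrite !big_ord_recr /=; lra.
Qed.

Lemma stage_start t : (1 <= t <= N.+1)%N -> regular_iterate t 1.
Proof.
elim: t => // t IH /andP[_]; rewrite ltnS => tN.
case: t IH tN => [|t] IH tN.
  rewrite /regular_iterate (_ : x 1%N 1%N = cst x11); last first.
    by apply/funext => w; exact: (iter_init iterates).
  split=> [j|]; first exact: measurable_cst.
  exact: (finite_measure_integrable_cst P (f x11 - fstar)).
have [r _] := stage_prefix (t := t.+1) tN (IH (leqW tN)) (leqnn _).
rewrite /regular_iterate (_ : x t.+2 1%N = x t.+1 (Sl t.+1).+1)//.
by apply/funext => w; exact: (iter_stage iterates).
Qed.

Lemma stage_bound t : (1 <= t <= N)%N ->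
  \sum_(i < Sl t) eta t i.+1 * mean_grad_sqr t i.+1 <=
    2 * (mean_gap t 1 - mean_gap t.+1 1) + L * sigma * \sum_(i < Sl t) eta t i.+1 ^+ 2.
Proof.
move=> ht; have /andP[t1 tN] := ht.
have [|_] := stage_prefix ht (stage_start _) (leqnn _).
  by rewrite t1 leqW.
rewrite {2}/mean_gap (_ : x t (Sl t).+1 = x t.+1 1%N)//.
by apply/funext => w; rewrite (iter_stage iterates).
Qed.

Lemma regular_query t i : query N Sl t i -> regular_iterate t i.
Proof.
move=> [/andP[t1 tN] /andP[i1 iS]].
case: i i1 iS => // i _ iS.
have h : (1 <= t <= N)%N by rewrite t1.
have h1 : regular_iterate t 1 by apply: stage_start; rewrite t1 leqW.
by have [] := stage_prefix h h1 (ltnW iS).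
Qed.

(** Needed because the output index is independent of the sigma-algebra of the whole run, which
    contains every earlier history. *)
Lemma grad_sqr_measurable_run t i : query N Sl t i ->
  measurable_wrt (history N Sl xi N.+1 1) (fun w => enorm (grad f (x t i w)) ^+ 2).
Proof.
move=> q B mB; apply: (history_subset_run q).
suff : measurable_wrt (history N Sl xi t i) (fun w => enorm (grad f (x t i w)) ^+ 2).
  by apply.
apply: history_enorm_sqr => j; have [_ _ m _] := unbiased q j.
exact: measurable_wrt_EFin.
Qed.

(** [mean_grad_sqr] is a real-valued integral, which would be a default value if the extended one
    were infinite; integrability excludes this. *)
Lemma mean_grad_sqrE t i : query N Sl t i ->
  (\int[P]_w (enorm (grad f (x t i w)) ^+ 2)%:E = (mean_grad_sqr t i)%:E)%E.
Proof.
move=> q; rewrite fineK//; apply: integrable_fin_num => //.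
have [_ ix] := regular_query q.
apply: (grad_sqr_integrable f_diff L_gt0 f_smooth f_ge _ (unbiased q) ix).
exact: history_measurable (oracle_random oracle).
Qed.

End run.

(** * Weighted sum over the stages and normalization by the output law *)

Theorem theoremA1
  (R : realType) (d : nat)
  (dO : measure_display) (Omega : measurableType dO) (P : probability Omega R)
  (dX : measure_display) (X : measurableType dX)
  (f : 'rV[R]_d -> R) (L fstar : R)
  (T N S : nat) (Sl : nat -> nat)
  (m M : R) (delta : nat -> R) (n : nat -> nat -> R)
  (x11 : 'rV[R]_d)
  (xi : nat -> nat -> Omega -> X)
  (g x : nat -> nat -> Omega -> 'rV[R]_d)
  (tstar istar : Omega -> nat)
  (rho sigma Delta0 : R)
  (f_diff : forall y, differentiable f y)
  (L_gt0 : 0 < L)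
  (f_smooth : forall y z,
     enorm (grad f y - grad f z) <= L * enorm (y - z))
  (f_min : (exists y, f y = fstar) /\ (forall y, fstar <= f y))
  (schedule : bandwidth_schedule T N Sl m M delta n)
  (iterates : sgd_iterates N Sl (step_size delta n) x11 g x)
  (oracle : stochastic_oracle N Sl xi g)
  (unbiased : unbiased_oracle P N Sl xi f g x)
  (rho_ge0 : 0 <= rho) (sigma_ge0 : 0 <= sigma)
  (variance : bounded_variance_oracle P N Sl xi f rho sigma g x)
  (indices : output_index P N Sl xi delta tstar istar)
  (Delta0_gt0 : 0 < Delta0)
  (gap : forall t, (1 <= t <= N.+1)%N ->
     ('E_P[(fun w => f (x t 1%N w) - fstar)%R] <= Delta0%:E)%E)
  (step_le : forall t i, query N Sl t i ->
     step_size delta n t i <= 1 / ((rho + 1) * L))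
  (S_ge1 : (1 <= S)%N)
  (Sl_const : forall t, (1 <= t <= N)%N -> Sl t = S)
  (delta_sqrt : forall t, (1 <= t <= N)%N -> delta t = 1 / Num.sqrt t%:R) :
  ('E_P[(fun w => enorm (grad f (output x tstar istar w)) ^+ 2)%R] <=
     (3 * Delta0 / m * (1 / Num.sqrt (S%:R * T%:R))
      + 3 * M ^+ 2 * L * sigma / (2 * m) * Num.sqrt (S%:R / T%:R))%:E)%E.
Proof.
have f_ge := f_min.2.
have N_gt0 := sched_N_gt0 schedule.
have m_gt0 := sched_m_gt0 schedule.
have M_gt0 : 0 < M := lt_le_trans m_gt0 (sched_m_le_M schedule).
pose eta := step_size delta n.
have qN t i : (t < N)%N -> (i < S)%N -> query N Sl t.+1 i.+1.
  by move=> tN iS; split=> //; rewrite Sl_const.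
have rpos (k : nat) : 0 < Num.sqrt (k.+1%:R : R) by rewrite sqrtr_gt0.
have deltaE t : (t < N)%N -> delta t.+1 = (Num.sqrt t.+1%:R)^-1.
  by move=> tN; rewrite delta_sqrt// div1r.
have eta_gt0 t i : query N Sl t i -> 0 < eta t i.
  move=> q; have /andP[mn _] := sched_n_band schedule q.
  by apply: mulr_gt0 (lt_le_trans m_gt0 mn) _; exact: (sched_delta_gt0 schedule q.1).
pose a t := mean_gap P f fstar x t 1.
pose G t i := mean_grad_sqr P f x t i.
have stage t : (t < N)%N ->
    \sum_(i < S) eta t.+1 i.+1 * G t.+1 i.+1 <=
    2 * (a t.+1 - a t.+2) + L * sigma * \sum_(i < S) eta t.+1 i.+1 ^+ 2.
  move=> tN; have := stage_bound f_diff L_gt0 f_smooth f_ge rho_ge0 sigma_ge0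
    iterates oracle unbiased variance eta_gt0 step_le (t := t.+1) tN.
  by rewrite Sl_const.
have a_ge0 t : 0 <= a t by apply: Rintegral_ge0 => w _; rewrite subr_ge0.
have a_le t : (1 <= t <= N.+1)%N -> a t <= Delta0.
  move=> ht; have := gap t ht; rewrite unlock -lee_fin; apply: le_trans.
  have [_ ix] := stage_start f_diff L_gt0 f_smooth f_ge rho_ge0 sigma_ge0
    iterates oracle unbiased variance eta_gt0 step_le ht.
  by rewrite /a /mean_gap fineK// integrable_fin_num.
have G_ge0 t i : 0 <= G t i by apply: Rintegral_ge0 => w _; exact: sqr_ge0.
(* With [r = sqrt t] the steps lie between [m / r] and [M / r]. Multiplying the stage bound by
   [t = r^2] leaves on the gradients the weight [r = 1 / delta(t)], the unnormalized output weight,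
   and a noise term that does not depend on [t]. *)
have weighted t : (t < N)%N -> m * (Num.sqrt t.+1%:R * \sum_(i < S) G t.+1 i.+1) <=
    2 * (t.+1%:R * (a t.+1 - a t.+2)) + L * sigma * (S%:R * M ^+ 2).
  move=> tN; set r := Num.sqrt _.
  have r2 : t.+1%:R = r ^+ 2 by rewrite sqr_sqrtr.
  have r0 : 0 < r := rpos t.
  have lo : m / r * \sum_(i < S) G t.+1 i.+1 <= \sum_(i < S) eta t.+1 i.+1 * G t.+1 i.+1.
    rewrite mulr_sumr; apply: ler_sum => i _; rewrite ler_wpM2r//.
    have /andP[mn _] := sched_n_band schedule (qN t i tN (ltn_ord i)).
    by rewrite /eta /step_size deltaE// ler_wpM2r// invr_ge0 ltW.
  have hi : \sum_(i < S) eta t.+1 i.+1 ^+ 2 <= S%:R * (M / r) ^+ 2.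
    rewrite -[S in S%:R]card_ord -sum1_card natr_sum mulr_suml.
    apply: ler_sum => i _; rewrite mul1r.
    have q := qN t i tN (ltn_ord i).
    have /andP[_ nM] := sched_n_band schedule q.
    rewrite lerXn2r ?nnegrE ?divr_ge0 ?(ltW M_gt0) ?(ltW r0) ?(ltW (eta_gt0 _ _ q))//.
    by rewrite /eta /step_size deltaE// ler_pM2r// invr_gt0.
  have lst := stage t tN.
  have LS : L * sigma * \sum_(i < S) eta t.+1 i.+1 ^+ 2 <= L * sigma * (S%:R * (M / r) ^+ 2).
    by rewrite ler_wpM2l// mulr_ge0// ltW.
  have := le_trans lo (le_trans lst (lerD (lexx _) LS)).
  rewrite -(ler_pM2l (exprn_gt0 2 r0)) => le; rewrite r2.
  apply: le_trans (le_trans le _); rewrite le_eqVlt; apply/orP; left; apply/eqP; field;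
    by rewrite gt_eqF.
set W := \sum_(t < N) Num.sqrt (t.+1%:R : R).
have W_ge : 2 * N%:R * Num.sqrt N%:R <= 3 * W := sum_sqrt_ge N.
have total : m * \sum_(t < N) Num.sqrt t.+1%:R * \sum_(i < S) G t.+1 i.+1 <=
    N%:R * (2 * Delta0 + L * sigma * (S%:R * M ^+ 2)).
  rewrite mulr_sumr; apply: (@le_trans _ _ (\sum_(t < N)
    (2 * (t.+1%:R * (a t.+1 - a t.+2)) + L * sigma * (S%:R * M ^+ 2)))).
    by apply: ler_sum => t _; exact: weighted.
  rewrite big_split /= -mulr_sumr sum_by_parts sumr_const card_ord (mulrDr N%:R) -(mulr_natl (L * sigma * _) N) lerD2r.
  rewrite mulrCA ler_wpM2l//; apply: (@le_trans _ _ (\sum_(t < N) a t.+1)).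
    (* The boundary term [N a_{N+1}] of the summation by parts is nonnegative and is dropped. *)
    by rewrite gerBl mulr_ge0.
  rewrite mulr_natl -[leRHS](_ : \sum_(t < N) Delta0 = _); last by rewrite sumr_const card_ord.
  by apply: ler_sum => t _; apply: a_le; rewrite /= ltnS ltnW.
have W_gt0 : 0 < W.
  rewrite -(pmulr_rgt0 _ (ltr0n R 3)); apply: lt_le_trans W_ge.
  by rewrite !mulr_gt0 ?sqrtr_gt0 ?ltr0n.
have WE : \sum_(1 <= l < N.+1) (delta l)^-1 = W.
  rewrite big_add1 big_mkord; apply: eq_bigr => t _.
  by rewrite deltaE// invrK.
(* Each pair has probability [sqrt t / (W S)], so the expectation is the sum bounded in [total]
   divided by [W S]. *)
have PE t i : (t < N)%N -> (i < S)%N ->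
    P [set w | tstar w = t.+1 /\ istar w = i.+1] = (Num.sqrt t.+1%:R / W / S%:R)%:E.
  move=> tN iS; rewrite (inner_uniform indices (qN t i tN iS)) (stage_law indices)//.
  by rewrite WE deltaE// invrK Sl_const// EFinM.
have meanE : ('E_P[(fun w => enorm (grad f (output x tstar istar w)) ^+ 2)%R] =
    ((\sum_(t < N) Num.sqrt t.+1%:R * \sum_(i < S) G t.+1 i.+1) / (W * S%:R))%:E)%E.
  have [mt mi] := index_measurable indices.
  rewrite unlock /output.
  rewrite (@expectation_output _ _ _ P (history N Sl xi N.+1 1) N S
    (fun t i w => enorm (grad f (x t i w)) ^+ 2))//.
  - rewrite mulr_suml -sumEFin; apply: eq_bigr => t _.
    rewrite mulr_sumr mulr_suml -sumEFin; apply: eq_bigr => i _.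
    rewrite PE// (mean_grad_sqrE f_diff L_gt0 f_smooth f_ge rho_ge0 sigma_ge0
      iterates oracle unbiased variance eta_gt0 step_le)//; last exact: qN.
    by rewrite -EFinM; congr EFin; rewrite invfM /G; ring.
  - exact: history_measurable (oracle_random oracle).
  - by move=> w; have [h1 h2] := index_range indices w; rewrite -(Sl_const _ h1).
  - move=> t i ht hi; apply: (grad_sqr_measurable_run unbiased).
    by split=> //; rewrite Sl_const.
  - by move=> t i w; exact: sqr_ge0.
  - exact: index_indep indices.
rewrite meanE lee_fin.
have TE : T%:R = N%:R * S%:R :> R.
  rewrite (sched_T_def schedule) -natrM; congr (_%:R).
  rewrite big_nat (eq_bigr (fun=> S)) -?big_nat; last by move=> t /Sl_const.
  by rewrite sum_nat_const_nat subn1.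
set s := \sum_(t < N) _ in total *.
have S_gt0 : 0 < S%:R :> R by rewrite ltr0n.
have Nr_gt0 : 0 < N%:R :> R by rewrite ltr0n.
set r := Num.sqrt N%:R in W_ge.
have r_gt0 : 0 < r by rewrite sqrtr_gt0.
have r2 : r ^+ 2 = N%:R by rewrite sqr_sqrtr.
(* Since [T = N S], the two roots of the claim are [S sqrt N] and [1 / sqrt N]. *)
have -> : Num.sqrt (S%:R * T%:R) = S%:R * r.
  by rewrite TE mulrCA mulrA -mulrA -expr2 sqrtrM// sqrtr_sqr gtr0_norm// mulrC.
have -> : Num.sqrt (S%:R / T%:R) = r^-1.
  rewrite TE (_ : _ / _ = N%:R^-1); last by field; rewrite !gt_eqF.
  by rewrite sqrtrV.
set C := 2 * Delta0 + L * sigma * (S%:R * M ^+ 2) in total.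
have C_ge0 : 0 <= C.
  by rewrite addr_ge0 ?mulr_ge0 ?sqr_ge0// ltW.
have -> : 3 * Delta0 / m * (1 / (S%:R * r)) + 3 * M ^+ 2 * L * sigma / (2 * m) * r^-1 =
          3 / 2 * C / (m * S%:R * r).
  by rewrite /C; field; rewrite !gt_eqF.
rewrite ler_pdivrMr ?mulr_gt0// -(ler_pM2l m_gt0).
(* [total] bounds the left side by [N C]; what remains is [2 N r <= 3 W], that is [W_ge], multiplied
   by [C / (2 r)]. *)
apply: le_trans total _.
have -> : m * (3 / 2 * C / (m * S%:R * r) * (W * S%:R)) = C * (3 * W) / (2 * r).
  by field; rewrite !gt_eqF.
rewrite ler_pdivlMr ?mulr_gt0// mulrC [leLHS](_ : _ = C * (2 * N%:R * r)); last by ring.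
by rewrite ler_wpM2l.
Qed.
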